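(* There exists a $4$-approximation algorithm for non-preemptive offline machine minimization when the processing times of all jobs are equal ($p_j=p$ for all jobs $j$).
   Context: Offline non-preemptive machine minimization: given (in advance) a finite set of jobs, each job $j$ with integer release date $r_j$, processing time $p_j$ and deadline $d_j$, find a schedule on as few identical machines as possible that processes each job uninterrupted on a single machine for $p_j$ consecutive time units within $[r_j,d_j]$, each machine processing at most one job at a time. $m$ is the optimal number of machines. A $4$-approximation algorithm is a (polynomial-time) algorithm that always outputs a feasible schedule using at most $4m$ machines. *)

(* Defs.v *)
From HB Require Import structures.
From mathcomp Require Import all_boot all_order all_algebra.

Set Implicit Arguments.
Unset Strict Implicit.
Unset Printing Implicit Defensive.

Import Order.TTheory GRing.Theory Num.Theory.
Local Open Scope ring_scope.

Record job := Job { release : int; proc : int; deadline : int }.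

Definition instance (n : nat) := 'I_n -> job.

(* Instances in which the machine minimization problem has a solution: given
   positive processing times, each job must fit into its own window. *)
Definition valid_instance n (J : instance n) : Prop :=
  forall j, 0 < proc (J j) /\ release (J j) + proc (J j) <= deadline (J j).

Definition equal_proc n (J : instance n) : Prop :=
  exists p : int, forall j, proc (J j) = p.

(* A non-preemptive schedule on k machines, with start times in R: job j
   occupies machine j during [start j, start j + proc j[. *)
Record schedule (R : Type) (n k : nat) :=
  Schedule { machine : 'I_n -> 'I_k; start : 'I_n -> R }.

Definition completion (R : realDomainType) n k (J : instance n)
    (S : schedule R n k) (j : 'I_n) : R :=
  start S j + (proc (J j))%:~R.

Definition feasible (R : realDomainType) n k (J : instance n)
    (S : schedule R n k) : Prop :=
  (forall j, (release (J j))%:~R <= start S j /\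
             completion J S j <= (deadline (J j))%:~R) /\
  (forall i j, i != j -> machine S i = machine S j ->
     completion J S i <= start S j \/ completion J S j <= start S i).

Definition schedulable (R : realDomainType) n (J : instance n) (k : nat) :=
  exists S : schedule R n k, feasible J S.

Definition optimal_machines (R : realDomainType) n (J : instance n) (m : nat) :=
  schedulable R J m /\ forall k, schedulable R J k -> (m <= k)%N.

(* Model of computation: a random access machine under the logarithmic cost
   criterion (Aho, Hopcroft, Ullman, "The Design and Analysis of Computer
   Algorithms", Section 1.3), programmed with structured control flow. The
   memory is a family of infinite arrays of integers; a program only names
   finitely many of them, but indexes each of them indirectly. Polynomial time
   in this model coincides with polynomial time on Turing machines. *)

Definition state := nat -> int -> int.

(* Length of the binary notation of |z|; the length of 0 is 1. *)
Definition bitlen (z : int) : nat := (trunc_log 2 `|z|%N).+1.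

Inductive op := Add | Sub | Mul | Div | Lt.

Inductive expr :=
| Cst of int
| Get of nat & expr
| Bin of op & expr & expr.

Definition eval_op (o : op) (x y : int) : int :=
  match o with
  | Add => x + y
  | Sub => x - y
  | Mul => x * y
  | Div => (x %/ y)%Z
  | Lt => (x < y)%R%:Z
  end.

Fixpoint eval (s : state) (e : expr) : int :=
  match e with
  | Cst z => z
  | Get a e1 => s a (eval s e1)
  | Bin o e1 e2 => eval_op o (eval s e1) (eval s e2)
  end.

(* Every subexpression is charged one plus the length of its value, so that
   operands, results, addresses and fetched contents are all paid for. *)
Fixpoint cost (s : state) (e : expr) : nat :=
  ((bitlen (eval s e)).+1 +
   match e with
   | Cst _ => 0
   | Get _ e1 => cost s e1
   | Bin _ e1 e2 => cost s e1 + cost s e2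
   end)%N.

(* Put a e1 e2 stores the value of e2 in array a at index e1; the guards of If
   and While succeed when their value is positive. *)
Inductive cmd :=
| Skip
| Put of nat & expr & expr
| Seq of cmd & cmd
| If of expr & cmd & cmd
| While of expr & cmd.

Definition update (s : state) (a : nat) (i v : int) : state :=
  fun b k => if (b == a) && (k == i) then v else s b k.

(* exec c s t s' : started in state s, the program c halts in state s' after
   time t. This relation is deterministic. *)
Inductive exec : cmd -> state -> nat -> state -> Prop :=
| ExecSkip s : exec Skip s 1 s
| ExecPut s a e1 e2 :
    exec (Put a e1 e2) s (cost s e1 + cost s e2).+1
         (update s a (eval s e1) (eval s e2))
| ExecSeq s1 s2 s3 c1 c2 t1 t2 :
    exec c1 s1 t1 s2 -> exec c2 s2 t2 s3 ->
    exec (Seq c1 c2) s1 (t1 + t2).+1 s3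
| ExecIfTrue s s' e c1 c2 t :
    0 < eval s e -> exec c1 s t s' ->
    exec (If e c1 c2) s (cost s e + t).+1 s'
| ExecIfFalse s s' e c1 c2 t :
    eval s e <= 0 -> exec c2 s t s' ->
    exec (If e c1 c2) s (cost s e + t).+1 s'
| ExecWhileTrue s1 s2 s3 e c t1 t2 :
    0 < eval s1 e -> exec c s1 t1 s2 -> exec (While e c) s2 t2 s3 ->
    exec (While e c) s1 (cost s1 e + t1 + t2).+1 s3
| ExecWhileFalse s e c :
    eval s e <= 0 -> exec (While e c) s (cost s e).+1 s.

Definition job_cell n (J : instance n) (f : job -> int) (z : int) : int :=
  match z with
  | Posz i => if insub i is Some j then f (J j) else 0
  | Negz _ => 0
  end.

(* Input convention: the number of jobs is in cell 0 of array 0; release dates,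
   processing times and deadlines are in cells 0, ..., n-1 of the arrays 1, 2
   and 3. All other cells are 0. *)
Definition input n (J : instance n) : state := fun a z =>
  match a with
  | 0%N => if z == 0 then n%:Z else 0
  | 1%N => job_cell J release z
  | 2%N => job_cell J proc z
  | 3%N => job_cell J deadline z
  | _ => 0
  end.

Definition input_size n (J : instance n) : nat :=
  (\sum_(j < n)
     (bitlen (release (J j)) + bitlen (proc (J j)) + bitlen (deadline (J j))))%N.

(* Output convention: upon halting, cells 0, ..., n-1 of the arrays 4 and 5 hold
   the machines and the start times of the jobs. *)
Definition outputs n k (s : state) (S : schedule int n k) : Prop :=
  forall j : 'I_n,
    s 4%N j%:Z = (machine S j)%:Z /\ s 5%N j%:Z = start S j.

(* The program c is a polynomial-time alpha-approximation algorithm for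
   non-preemptive machine minimization on the instances satisfying P. The output
   is compared with the optimum over schedules with start times in any
   archimedean ordered domain, so both integral and real start times are
   covered. *)
Definition approximation_algorithm (alpha : nat)
    (P : forall n, instance n -> Prop) (c : cmd) : Prop :=
  exists q : {poly nat}, forall n (J : instance n),
    valid_instance J -> P n J ->
    exists (t : nat) (s : state) (k : nat) (S : schedule int n k),
      [/\ exec c (input J) t s,
          (t <= q.[input_size J])%N,
          outputs s S,
          feasible J S
        & forall (R : archiRealDomainType) (m : nat),
            optimal_machines R J m -> (k <= alpha * m)%N].

(* Main.v *)
(* Cut time into slots [t p, (t + 1) p[. A job is long if its window contains a whole
   slot, and short otherwise; the window of a short job lies inside two consecutive
   slots, and the job runs across the boundary between them in every schedule.

   At most m short jobs cross a given boundary, and those of boundaries at distance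
   at least 2 p do not interfere. Starting every short job at its release date hence
   takes 2 m machines, m for each parity of the boundary.

   In an optimal schedule, a long job started in slot t can be moved to slot t or to
   slot t + 1, so that the long jobs fit into slots with at most 2 m jobs per slot.
   For a guessed number c of jobs per slot, handling the jobs by nondecreasing
   deadlines and putting each in its first slot with fewer than c jobs is optimal: a
   failure exhibits an interval of D slots containing the windows of more than c D
   jobs, and then c is incremented. Hence c <= 2 m throughout. *)

From mathcomp Require Import all_boot all_order all_algebra.
From mathcomp Require Import zify.
Require Import Defs.

Set Implicit Arguments.
Unset Strict Implicit.
Unset Printing Implicit Defensive.

Import Order.TTheory GRing.Theory Num.Theory.
Local Open Scope ring_scope.

(** * Rounding of start times, and a counting argument of Hall type *)

(** All data are integers, so rounding every start time down preserves windows and separation. *)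
Lemma int_schedule (R : archiRealDomainType) n k (J : instance n) :
  schedulable R J k -> schedulable int J k.
Proof.
case=> S [win sep]; exists (Schedule (machine S) (fun j => Num.floor (start S j))).
split=> [j|i j ij /(sep i j ij)]; rewrite /completion /= ?intz.
  have [rj dj] := win j; split; first by rewrite floor_ge_int.
  rewrite -(ler_int R) intrD; apply: le_trans dj.
  by rewrite /completion lerD2r floor_le.
by case=> H; [left|right]; rewrite floor_ge_int intrD; apply: le_trans H;
  rewrite /completion lerD2r floor_le.
Qed.

Lemma card_slots n (P : {set 'I_n}) (sigma : 'I_n -> int) (c D : nat) (t0 : int) :
  (forall d, (d < D)%N -> (c <= #|[set i in P | (sigma i == t0 + d%:Z)%R]|)%N) ->
  (c * D <= #|[set i in P | (t0 <= sigma i < t0 + D%:Z)%R]|)%N.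
Proof.
elim: D => [|D IH] H; first by rewrite muln0.
have {}IH := IH (fun d dD => H d (ltnW dD)).
rewrite mulnSr; apply: (leq_trans (leq_add IH (H D (ltnSn D)))).
rewrite -cardsUI [X in (_ + X)%N](_ : _ = 0%N) ?addn0.
  apply: subset_leq_card; apply/subsetP => i; rewrite !inE.
  by case: (i \in P) => //=; lia.
apply/eqP; rewrite cards_eq0; apply/eqP/setP => i; rewrite !inE.
by case: (i \in P) => //=; lia.
Qed.

(** Here [sigma] is a greedy placement, a slot is full when it holds at least c jobs, and job j
    finds only full slots. Extend the run of full slots ending at [hi j] to the left as far as the
    first slot [lo i] of some job: the jobs placed in it have their windows inside, and j is one
    more. *)
Lemma hall_violation n (lo hi : 'I_n -> int) (P : {set 'I_n}) (sigma : 'I_n -> int)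
    (c : nat) (j : 'I_n) :
  (forall i, i \in P -> [/\ lo i <= sigma i, sigma i < hi i & hi i <= hi j]) ->
  (forall i t, i \in P -> lo i <= t < sigma i ->
     (c <= #|[set l in P | sigma l == t]|)%N) ->
  j \notin P -> lo j < hi j ->
  (forall t, lo j <= t < hi j -> (c <= #|[set l in P | sigma l == t]|)%N) ->
  exists2 t0 : int, t0 < hi j &
    (c * `|(hi j - t0)%R| < #|[set l | [&& lo l < hi l, t0 <= lo l & hi l <= hi j]%R]|)%N.
Proof.
move=> Hwin Hearly jP ljhj Hfull.
pose full (l : 'I_n) := all (fun d : nat =>
  (c <= #|[set i in P | (sigma i == lo l + d%:Z)%R]|)%N) (iota 0 `|(hi j - lo l)%R|).
have fullP l : lo l <= hi j ->
   full l <-> forall t, lo l <= t < hi j -> (c <= #|[set i in P | sigma i == t]|)%N.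
  move=> lh; split=> [/allP H t tb|H].
    have -> : t = lo l + `|t - lo l|%N%:Z by lia.
    by apply: H; rewrite mem_iota; lia.
  by apply/allP => d; rewrite mem_iota => db; apply: H; lia.
have fullj : full j by apply/fullP => //; lia.
case: (Order.TotalTheory.arg_minP lo fullj) => i fi mini.
have lij : lo i <= lo j by exact: mini.
have Hi := (fullP i (ltW (le_lt_trans lij ljhj))).1 fi.
exists (lo i); first lia.
have /card_slots : forall d, (d < `|(hi j - lo i)%R|)%N ->
   (c <= #|[set l in P | (sigma l == lo i + d%:Z)%R]|)%N by move=> d db; apply: Hi; lia.
move/leq_ltn_trans; apply; apply: proper_card; apply/properP; split; last first.
  by exists j; rewrite !inE ?(negbTE jP) ?ljhj ?lij ?lexx.
apply/subsetP => l; rewrite !inE => /andP[lP /andP[sl slu]].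
have [a1 a2 a3] := Hwin l lP.
apply/and3P; split => //; first exact: le_lt_trans a1 a2.
(* If [lo l < lo i], the slots from [lo l] to [sigma l] would be full by earliest placement and the
   later ones by choice of i, against the minimality of [lo i]. *)
rewrite leNgt; apply/negP => ll.
suff /mini : full l by lia.
apply/fullP; first lia.
move=> t tb; have [ts|ts] := ltP t (sigma l); first by apply: (Hearly l) => //; lia.
by apply: Hi; lia.
Qed.

(** * Slots *)

Section EqualProcessingTimes.

Variables (n : nat) (J : instance n) (p : int).
Hypotheses (validJ : valid_instance J) (procJ : forall j, proc (J j) = p).

(** Ceiling of r/p and floor of d/p: the whole slots in the window of j run from [slot_lo j] to
    [slot_hi j - 1], so j is long when [slot_lo j < slot_hi j]. *)
Definition slot_lo j := ((release (J j) + proc (J j) - 1) %/ proc (J j))%Z.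
Definition slot_hi j := (deadline (J j) %/ proc (J j))%Z.

Let lo := slot_lo.
Let hi := slot_hi.

(** The argument j matters: p is arbitrary when there are no jobs. *)
Lemma proc_gt0 (j : 'I_n) : 0 < p.
Proof. by rewrite -(procJ j); case: (validJ j). Qed.

Lemma divz_bounds (x : int) (j : 'I_n) :
  (x %/ p)%Z * p <= x /\ x < ((x %/ p)%Z + 1) * p.
Proof.
have p0 := proc_gt0 j; split; first by apply: lez_floor; rewrite gt_eqF.
exact: ltz_ceil.
Qed.

Lemma release_bounds j : release (J j) <= lo j * p /\ (lo j - 1) * p < release (J j).
Proof.
rewrite /lo /slot_lo procJ; have [] := divz_bounds (release (J j) + p - 1) j; lia.
Qed.

Lemma deadline_bounds j : hi j * p <= deadline (J j) /\ deadline (J j) < (hi j + 1) * p.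
Proof. by rewrite /hi /slot_hi procJ; exact: divz_bounds. Qed.

(** A window of length at least p contains a multiple of p, whence [lo j <= hi j] for every job. *)
Lemma short_lo_eq_hi j : hi j <= lo j -> hi j = lo j.
Proof.
have [_ a] := release_bounds j; have [_ b] := deadline_bounds j.
have := (validJ j).2; rewrite procJ => c h; have p0 := proc_gt0 j.
apply/eqP; rewrite eq_le h -ltzD1 -(ltr_pM2r p0); move: (lo j) (hi j) a b {h} => x y; idtac; nia.
Qed.

Section Optimum.

Variables (m : nat) (S : schedule int n m).
Hypothesis feasS : feasible J S.

Lemma feasible_start j : release (J j) <= start S j /\ start S j + p <= deadline (J j).
Proof. by have := feasS.1 j; rewrite /completion procJ !intz. Qed.

Lemma feasible_close i j : machine S i = machine S j ->
  `|start S i - start S j| < p -> i = j.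
Proof.
move=> mij d; apply/eqP; rewrite -[_ == _]negbK; apply/negP => ij.
have := feasS.2 i j ij mij; rewrite /completion !procJ !intz.
by move: (start S i : int) (start S j : int) d => x y; lia.
Qed.

(* A short job runs across the boundary lo * p. *)
Lemma short_group_card (i : 'I_n) :
  (#|[set j : 'I_n | (hi j <= lo j)%R && (lo j == lo i)]| <= m)%N.
Proof.
rewrite -[X in (_ <= X)%N]card_ord -(card_in_imset (f := machine S)); first exact: max_card.
move=> j l; rewrite !inE => /andP[/short_lo_eq_hi hj /eqP ej] /andP[/short_lo_eq_hi hl /eqP el].
move=> mjl; apply: feasible_close => //.
have [_] := release_bounds j; have [_] := deadline_bounds j.
have [_] := release_bounds l; have [_] := deadline_bounds l.
have [] := feasible_start j; have [] := feasible_start l.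
by rewrite hj hl ej el; move: (start S j : int) (start S l : int) => x y; lia.
Qed.

(** The job moves back to the beginning of the slot where it starts, or forward to the next slot if
    that would precede its first whole slot. *)
Definition aligned_slot j :=
  let q := (start S j %/ p)%Z in if lo j <= q then q else q + 1.

Lemma aligned_slot_window j : lo j < hi j ->
  lo j <= aligned_slot j /\ aligned_slot j < hi j.
Proof.
move=> lh; have p0 := proc_gt0 j; rewrite /aligned_slot.
have [a b] := divz_bounds (start S j) j.
have [c d] := release_bounds j; have [e f] := deadline_bounds j.
have [g h] := feasible_start j; set q := (_ %/ _)%Z in a b *.
have q1 : q < hi j by rewrite -(ltr_pM2r p0); lia.
have q2 : lo j <= q + 1.
  by rewrite -lerBlDr -ltzD1 -(ltr_pM2r p0); lia.
case: ifP => // /negbT; rewrite -ltNge; lia.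
Qed.

(* At most two jobs per machine can be moved into any given slot: one started in
   that slot and one started in the preceding slot. *)
Lemma long_jobs_card (t0 t1 : int) : t0 < t1 ->
  (#|[set l | [&& (lo l < hi l)%R, (t0 <= lo l)%R & (hi l <= t1)%R]]| <=
    2 * m * `|(t1 - t0)%R|)%N.
Proof.
move=> t01; set W := [set l | _].
have [T ET] : exists T, `|(t1 - t0)%R|%N = T.+1 by exists `|(t1 - t0 - 1)%R|%N; lia.
(* Rounding direction, machine and target slot determine the slot in which j starts, and two jobs on
   one machine cannot start in the same slot. The length is written as a successor for [inord]. *)
pose f j : bool * 'I_m * 'I_T.+1 :=
  (lo j <= start S j %/ p, machine S j, inord `|(aligned_slot j - t0)%R|%N)%Z.
rewrite ET.
suff fI : {in W &, injective f}.
  rewrite -(card_in_imset fI); apply: (leq_trans (max_card _)).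
  by rewrite !card_prod card_bool !card_ord.
move=> i j; rewrite !inE => /and3P[wi ai bi] /and3P[wj aj bj] [e1 e2] /(congr1 val).
have [ui vi] := aligned_slot_window wi; have [uj vj] := aligned_slot_window wj.
rewrite !val_insubd; case: ifP; case: ifP; try lia.
move=> _ _ es; have {}es : aligned_slot i = aligned_slot j by lia.
have eq : (start S i %/ p = start S j %/ p)%Z.
  by move: es; rewrite /aligned_slot e1; case: ifP; lia.
apply: feasible_close => //.
have [a b] := divz_bounds (start S i) i; have [c d] := divz_bounds (start S j) j.
rewrite eq in a b; lia.
Qed.

End Optimum.

End EqualProcessingTimes.

(** * Greedy assignment of the long jobs *)

Section Greedy.

Variables (n : nat) (lo hi : 'I_n -> int) (rank : 'I_n -> nat).
Hypothesis rank_inj : injective rank.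
Hypothesis rank_hi : forall i j, (rank i <= rank j)%N -> hi i <= hi j.

(** Certificate, by pigeonhole, that g jobs per slot are too few for the long jobs. *)
Definition hall_witness (g : nat) := exists t0 t1 : int, t0 < t1 /\
  (g * `|(t1 - t0)%R| < #|[set l | [&& lo l < hi l, t0 <= lo l & hi l <= t1]%R]|)%N.

Definition placed (k : nat) : {set 'I_n} := [set j | (rank j < k)%N && (lo j < hi j)%R].

Definition load (slot : 'I_n -> int) (k : nat) (t : int) : nat :=
  #|[set j in placed k | slot j == t]|.

(** State of the greedy procedure with up to g + 1 jobs per slot: the long jobs of rank below k are
    placed, and the first x slots examined for the job of rank k are full. [level] numbers the jobs
    within a slot and later selects the machine; [greedy_witness] records why the guess was raised
    to g. *)
Record greedy (g k x : nat) (slot : 'I_n -> int) (level : 'I_n -> nat) : Prop :=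
  Greedy {
  greedy_le_n : (x <= n)%N;
  greedy_witness : g = 0%N \/ hall_witness g;
  greedy_window : forall j, j \in placed k -> lo j <= slot j < hi j;
  greedy_level : forall j, j \in placed k ->
    (level j < load slot k (slot j))%N && (level j <= g)%N;
  greedy_distinct : forall i j, i \in placed k -> j \in placed k ->
    i != j -> slot i = slot j -> level i != level j;
  greedy_earliest : forall j t, j \in placed k -> lo j <= t < slot j ->
    (g < load slot k t)%N;
  greedy_current : forall j t, rank j = k -> lo j <= t < lo j + x%:Z ->
    (g < load slot k t)%N }.

Lemma placed0 : placed 0 = set0.
Proof. by apply/setP => j; rewrite !inE. Qed.

Lemma greedy0 g slot level : g = 0%N \/ hall_witness g -> greedy g 0 0 slot level.
Proof.
move=> H; split=> // [i|i|i j|i t|i t _]; rewrite ?placed0 ?inE //; lia.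
Qed.

Lemma load0 slot t : load slot 0 t = 0%N.
Proof.
rewrite /load placed0; apply/eqP; rewrite cards_eq0; apply/eqP/setP=> j.
by rewrite !inE.
Qed.

(** The interval has at least one slot and there are only n jobs. This bounds the number of
    guesses. *)
Lemma hall_witness_ltn g : hall_witness g -> (g < n)%N.
Proof.
case=> t0 [t1 [t01]] /leq_trans/(_ (max_card _)); rewrite card_ord.
by apply: leq_ltn_trans; rewrite -[X in (X <= _)%N]muln1 leq_mul2l; lia.
Qed.

Lemma placed_short j : hi j <= lo j -> placed (rank j).+1 = placed (rank j).
Proof.
move=> s; apply/setP => i; rewrite !inE ltnS leq_eqVlt.
by have [/rank_inj->|//] := eqVneq (rank i) (rank j); rewrite ltNge s !andbF.
Qed.

Lemma placed_long j : lo j < hi j -> placed (rank j).+1 = j |: placed (rank j).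
Proof.
move=> s; apply/setP => i; rewrite !inE ltnS leq_eqVlt (inj_eq rank_inj).
by case: eqVneq => // ->; rewrite s.
Qed.

Lemma notin_placed j : j \notin placed (rank j).
Proof. by rewrite inE ltnn. Qed.

Section Step.

Variables (g x : nat) (slot : 'I_n -> int) (level : 'I_n -> nat) (j : 'I_n).
Hypothesis G : greedy g (rank j) x slot level.

Lemma load_skip t : hi j <= lo j -> load slot (rank j).+1 t = load slot (rank j) t.
Proof. by move=> s; rewrite /load placed_short. Qed.

Lemma greedy_skip : hi j <= lo j -> greedy g (rank j).+1 0 slot level.
Proof.
move=> s; case: G => G1 G2 G3 G4 G5 G6 G7.
split=> // [i|i|i l|i t|i t _]; rewrite ?placed_short ?load_skip //; last by lia.
- exact: G3.
- exact: G4.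
- exact: G5.
- exact: G6.
Qed.

Lemma greedy_next : (g < load slot (rank j) (lo j + x%:Z))%N ->
  greedy g (rank j) x.+1 slot level.
Proof.
move=> H; case: G => G1 G2 G3 G4 G5 G6 G7.
have C i t : rank i = rank j -> lo i <= t < lo i + x.+1%:Z ->
    (g < load slot (rank j) t)%N.
  move=> /rank_inj -> tb; have [tx|tx] := ltP t (lo j + x%:Z); first by apply: (G7 j) => //; lia.
  by have -> : t = lo j + x%:Z by lia.
split=> //.
(* Each of the x + 1 slots examined holds at least one of the n jobs. *)
have /card_slots : forall d, (d < x.+1)%N ->
   (1 <= #|[set l in placed (rank j) | (slot l == lo j + d%:Z)%R]|)%N.
  by move=> d db; apply: leq_ltn_trans (C j _ erefl _); rewrite ?leq0n //; lia.
by rewrite mul1n => /leq_trans; apply; rewrite -[X in (_ <= X)%N]card_ord max_card.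
Qed.

(** The whole window of j is full with g + 1 jobs per slot, so [hall_violation] applies with c = g +
    1. *)
Lemma greedy_fail : lo j < hi j -> hi j <= lo j + x%:Z -> hall_witness g.+1.
Proof.
move=> l e; case: G => G1 G2 G3 G4 G5 G6 G7.
have [|||||t0 t01 H] := @hall_violation n lo hi (placed (rank j)) slot g.+1 j.
- move=> i ip; have /andP[-> ->] := G3 i ip; split=> //; apply: rank_hi.
  by move: ip; rewrite inE => /andP[/ltnW].
- by move=> i t ip tb; apply: G6 tb.
- exact: notin_placed.
- exact: l.
- by move=> t tb; apply: (G7 j) => //; lia.
by exists t0, (hi j).
Qed.

Hypotheses (lj : lo j < hi j) (in_window : lo j + x%:Z < hi j).
Hypothesis free : (load slot (rank j) (lo j + x%:Z) <= g)%N.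

Let slot' i := if i == j then lo j + x%:Z else slot i.
(** The levels in a slot are below its load, so the load itself is a fresh level. *)
Let level' i := if i == j then load slot (rank j) (lo j + x%:Z) else level i.

Lemma load_place t :
  load slot' (rank j).+1 t = (load slot (rank j) t + (t == lo j + x%:Z)%R)%N.
Proof.
rewrite /load placed_long //.
have neq i : i \in placed (rank j) -> i == j = false.
  by apply: contraTF => /eqP->; exact: notin_placed.
have E : [set i in placed (rank j) | slot' i == t] = [set i in placed (rank j) | slot i == t].
  by apply/setP => i; rewrite !inE /slot'; case: (eqVneq i j) => [->|//]; rewrite ltnn.
rewrite -E; have [et|ne] := eqVneq t (lo j + x%:Z).
  rewrite addn1 (_ : [set i in _ | _] = j |: [set i in placed (rank j) | slot' i == t]).
    by rewrite cardsU1 !inE ltnn.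
  by apply/setP => i; rewrite !inE; case: (eqVneq i j) => [->|//]; rewrite /slot' et !eqxx.
rewrite addn0; apply: eq_card => i; rewrite !inE.
by case: (eqVneq i j) => [->|//]; rewrite /slot' eqxx eq_sym (negbTE ne) !andbF.
Qed.

Lemma greedy_place : greedy g (rank j).+1 0 slot' level'.
Proof.
case: G => G1 G2 G3 G4 G5 G6 G7.
have neq i : i \in placed (rank j) -> i == j = false.
  by apply: contraTF => /eqP->; exact: notin_placed.
split=> //.
- move=> i; rewrite placed_long // !inE /slot'.
  have [-> _|_ /= ip] := eqVneq i j; first by lia.
  by apply: G3; rewrite inE.
- move=> i; rewrite placed_long // in_setU1 load_place /slot' /level'.
  have [-> _|_ /= ip] := eqVneq i j; first by rewrite eqxx addn1 ltnSn.
  by have /andP[a b] := G4 i ip; rewrite b andbT (leq_trans a) // leq_addr.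
- move=> i l; rewrite placed_long // !in_setU1 /slot' /level'.
  have [->|ij] := eqVneq i j; have [->|lj'] := eqVneq l j; rewrite ?eqxx //=.
  + by move=> _ lp _ E; have /andP[+ _] := G4 l lp; rewrite -E; lia.
  + by move=> ip _ _ E; have /andP[+ _] := G4 i ip; rewrite E; lia.
  + exact: G5.
- move=> i t; rewrite placed_long // in_setU1 load_place /slot'.
  have [-> _ tb|_ /= ip tb] := eqVneq i j; apply: leq_trans (leq_addr _ _).
    exact: (G7 j).
  exact: G6 ip tb.
- by move=> i t _; lia.
Qed.

End Step.

End Greedy.

(** * Running time *)

Section CostModel.

Fixpoint expr_size (e : expr) : nat :=
  match e with
  | Cst _ => 1
  | Get _ e1 => (expr_size e1).+1
  | Bin _ e1 e2 => (expr_size e1 + expr_size e2).+1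
  end.

(** The constants of the program are at most 4 = 2 ^ 2, hence at most 2 ^ B. *)
Fixpoint small_consts (e : expr) : bool :=
  match e with
  | Cst z => (`|z|%N <= 4)%N
  | Get _ e1 => small_consts e1
  | Bin _ e1 e2 => small_consts e1 && small_consts e2
  end.

Variable B : nat.
Hypothesis B_ge2 : (2 <= B)%N.

Definition bounded (s : state) := forall a z, (`|s a z|%N <= 2 ^ B)%N.

(** Products add exponents; the extra one absorbs sums and differences, and a quotient never exceeds
    its numerator in absolute value, even for the divisor 0. *)
Lemma absz_eval_op o x y a b : (`|x| <= 2 ^ a)%N -> (`|y| <= 2 ^ b)%N ->
  (`|eval_op o x y| <= 2 ^ (a + b).+1)%N.
Proof.
move=> xa yb; have l2 c d : (2 ^ c <= 2 ^ (c + d))%N by rewrite leq_exp2l ?leq_addr.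
have xab := leq_trans xa (l2 a b).
have yab : (`|y| <= 2 ^ (a + b))%N by apply: leq_trans yb _; rewrite addnC.
rewrite expnS; case: o => /=; try lia.
- by rewrite abszM; apply: leq_trans (leq_mul xa yb) _; rewrite -expnD; lia.
- suff : (`|(x %/ y)%Z| <= `|x|)%N by lia.
  have [->|y0] := eqVneq y 0; first by rewrite divz0.
  have [l u] := (lez_floor x y0, ltz_mod x y0); have m0 := modz_ge0 x y0.
  have e := divz_eq x y.
  move: (x %/ y)%Z (x %% y)%Z l u m0 e => q r l u m0 e; nia.

Qed.

Lemma absz_eval s e : bounded s -> small_consts e ->
  (`|eval s e| <= 2 ^ (B * expr_size e))%N.
Proof.
move=> bs; elim: e => [z|a e IH|o e1 IH1 e2 IH2] /=.
- by rewrite muln1 => /leq_trans; apply; rewrite -[4%N]/(2 ^ 2)%N leq_exp2l.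
- move=> _; apply: leq_trans (bs _ _) _; rewrite leq_exp2l //; nia.
- move=> /andP[/IH1 h1 /IH2 h2]; apply: leq_trans (absz_eval_op _ h1 h2) _.
  by rewrite leq_exp2l //; nia.
Qed.

Lemma bitlen_le z k : (`|z|%N <= 2 ^ k)%N -> (bitlen z <= k.+1)%N.
Proof. by move/(leq_trunc_log 2); rewrite trunc_expnK. Qed.

(** Each node has a value of at most [B * expr_size e + 1] bits and is charged one more. *)
Lemma cost_le s e : bounded s -> small_consts e ->
  (cost s e <= expr_size e * (B * expr_size e + 2))%N.
Proof.
move=> bs; have arith b c k : (b <= (B * k.+1).+1 -> c <= k * (B * k + 2) ->
  b.+1 + c <= k.+1 * (B * k.+1 + 2))%N by nia.
elim: e => [z|a e IH|o e1 IH1 e2 IH2] h; apply: arith; rewrite ?bitlen_le ?absz_eval //.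
  exact: IH.
move: h => /= /andP[/IH1 h1 /IH2 h2].
rewrite mulnDl leq_add // (leq_trans h1, leq_trans h2) // leq_mul2l leq_add2r leq_mul2l;
  by rewrite (leq_addr, leq_addl) !orbT.
Qed.

Variable W : nat.

(* One unit pays for a command without its subcommands, whatever the state, as long
   as its expressions are cheap and all cells are at most 2 ^ B. *)
Definition unit_cost := (2 * (W * (B * W + 2))).+1.

Definition cheap (e : expr) := (expr_size e <= W)%N && small_consts e.

Lemma cheap_cost s e : bounded s -> cheap e -> (cost s e <= W * (B * W + 2))%N.
Proof.
move=> bs /andP[w h]; apply: leq_trans (cost_le bs h) _.
by apply: leq_mul => //; rewrite leq_add2r leq_mul2l w orbT.
Qed.

(** A Hoare triple for total correctness, with a time budget of N units and the bound on all cells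
    as a standing invariant. *)
Definition run (c : cmd) (s : state) (N : nat) (Q : state -> Prop) : Prop :=
  exists t s', [/\ exec c s t s', (t <= N * unit_cost)%N, bounded s' & Q s'].

Lemma run_weaken c s N N' (Q Q' : state -> Prop) : (N <= N')%N ->
  (forall s', bounded s' -> Q s' -> Q' s') -> run c s N Q -> run c s N' Q'.
Proof.
move=> NN QQ [t [s' [e tN b q]]]; exists t, s'; split=> //; last exact: QQ.
by apply: leq_trans tN _; rewrite leq_mul2r NN orbT.
Qed.

Lemma bounded_update s a z v : bounded s -> (`|v|%N <= 2 ^ B)%N ->
  bounded (update s a z v).
Proof. by move=> bs bv b y; rewrite /update; case: ifP. Qed.

Lemma run_put a e1 e2 s (Q : state -> Prop) :
  bounded s -> cheap e1 -> cheap e2 -> (`|eval s e2|%N <= 2 ^ B)%N ->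
  Q (update s a (eval s e1) (eval s e2)) -> run (Put a e1 e2) s 1 Q.
Proof.
move=> bs c1 c2 be q; exists (cost s e1 + cost s e2).+1, (update s a (eval s e1) (eval s e2)).
split=> //; first exact: ExecPut; last exact: bounded_update.
by have := cheap_cost bs c1; have := cheap_cost bs c2; rewrite /unit_cost; lia.
Qed.

Lemma run_seq c1 c2 s N1 N2 (Q : state -> Prop) :
  run c1 s N1 (fun s1 => bounded s1 -> run c2 s1 N2 Q) -> run (Seq c1 c2) s (N1 + N2).+1 Q.
Proof.
case=> t1 [s1 [e1 b1 bs1 /(_ bs1) [t2 [s2 [e2 b2 bs2 q]]]]].
exists (t1 + t2).+1, s2; split=> //; first exact: ExecSeq e1 e2.
by rewrite /unit_cost in b1 b2 *; nia.
Qed.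

Lemma run_put_seq a e1 e2 c s N (Q : state -> Prop) :
  bounded s -> cheap e1 -> cheap e2 -> (`|eval s e2|%N <= 2 ^ B)%N ->
  (bounded (update s a (eval s e1) (eval s e2)) ->
   run c (update s a (eval s e1) (eval s e2)) N Q) ->
  run (Seq (Put a e1 e2) c) s N.+2 Q.
Proof. by move=> bs c1 c2 be q; apply: (run_seq (N1 := 1)); apply: run_put. Qed.

Lemma run_if e c1 c2 s N (Q : state -> Prop) :
  bounded s -> cheap e ->
  (0 < eval s e -> run c1 s N Q) -> (eval s e <= 0 -> run c2 s N Q) ->
  run (If e c1 c2) s N.+1 Q.
Proof.
move=> bs ce H1 H2; have ec := cheap_cost bs ce.
have [e0|e0] := lerP (eval s e) 0.
  have [t [s' [ex b bs' q]]] := H2 e0; exists (cost s e + t).+1, s'; split=> //.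
    exact: ExecIfFalse.
  by rewrite /unit_cost in b *; nia.
have [t [s' [ex b bs' q]]] := H1 e0; exists (cost s e + t).+1, s'; split=> //.
  exact: ExecIfTrue.
by rewrite /unit_cost in b *; nia.
Qed.

Lemma run_while e c (I : nat -> state -> Prop) N M v s :
  cheap e -> bounded s -> I v s ->
  (forall v s, I v s -> bounded s -> 0 < eval s e -> (v < N)%N /\
     run c s M (fun s' => exists2 v', (v < v')%N & I v' s')) ->
  run (While e c) s ((N - v) * M.+1 + 1) (fun s' => eval s' e <= 0 /\ exists v', I v' s').
Proof.
move=> ce bs Iv step; have [d] := ubnP (N - v).
elim: d v s bs Iv => // d IH v s bs Iv vd; have ec := cheap_cost bs ce.
have [e0|e0] := lerP (eval s e) 0.
  exists (cost s e).+1, s; split=> //; first exact: ExecWhileFalse.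
  - by rewrite /unit_cost; nia.
  - by split=> //; exists v.
have [vN [t1 [s1 [ex1 b1 bs1 [v' vv' Iv']]]]] := step _ _ Iv bs e0.
have [|t2 [s2 [ex2 b2 bs2 q]]] := IH _ _ bs1 Iv'; first by lia.
exists (cost s e + t1 + t2).+1, s2; split=> //; first exact: ExecWhileTrue ex1 ex2.
have : ((N - v') * M.+1 + M.+1 <= (N - v) * M.+1)%N by nia.
move: ((N - v') * _)%N ((N - v) * _)%N b2 => x y b2 xy.
have : ((cost s e).+1 <= unit_cost)%N by rewrite /unit_cost; lia.
by move: (cost s e) unit_cost b1 b2 => z u; nia.
Qed.

End CostModel.

(** * The program *)

Local Notation "x +! y" := (Bin Add x y) (at level 50, left associativity).
Local Notation "x -! y" := (Bin Sub x y) (at level 50, left associativity).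
Local Notation "x *! y" := (Bin Mul x y) (at level 40, left associativity).
Local Notation "x /! y" := (Bin Div x y) (at level 40, left associativity).
Local Notation "x <! y" := (Bin Lt x y) (at level 70).
Local Notation "c1 ;; c2" := (Seq c1 c2) (at level 90, right associativity).

Definition var (a : nat) : expr := Get a (Cst 0).

Definition lo_expr (e : expr) : expr := (Get 1 e +! Get 2 e -! Cst 1) /! Get 2 e.
Definition hi_expr (e : expr) : expr := Get 3 e /! Get 2 e.
Definition key_expr (e : expr) : expr := Get 3 e *! var 0 +! e.

Lemma evalE (s : state) :
  (forall a, eval s (var a) = s a 0) * (forall z, eval s (Cst z) = z) *
  (forall a e, eval s (Get a e) = s a (eval s e)) *
  (forall x y, eval s (x +! y) = eval s x + eval s y) *
  (forall x y, eval s (x -! y) = eval s x - eval s y) *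
  (forall x y, eval s (x *! y) = eval s x * eval s y) *
  (forall x y, eval s (x /! y) = (eval s x %/ eval s y)%Z) *
  (forall x y, eval s (x <! y) = (eval s x < eval s y)%R%:Z).
Proof. by []. Qed.

(* Cell 0 of array 6 runs through the pairs (row, col), encoded as row * n + col. *)
Definition row_expr : expr := var 6 /! var 0.
Definition col_expr : expr := var 6 -! row_expr *! var 0.

Definition rank_loop : cmd :=
  While (var 6 <! var 0 *! var 0)
    (Put 7 row_expr (Get 7 row_expr +! (key_expr col_expr <! key_expr row_expr)) ;;
     Put 6 (Cst 0) (var 6 +! Cst 1)).

(* Arrays: 9 lists the jobs by rank, 8 counts the short jobs around each boundary.
   The long jobs also get a machine and a start time here, to be overwritten. *)
Definition short_loop : cmd :=
  While (var 10 <! var 0)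
    (Put 9 (Get 7 (var 10)) (var 10) ;;
     Put 4 (var 10) (Cst 4 *! Get 8 (lo_expr (var 10)) +!
       (Cst 2 *! (lo_expr (var 10) -! Cst 2 *! (lo_expr (var 10) /! Cst 2)) +! Cst 1)) ;;
     Put 5 (var 10) (Get 1 (var 10)) ;;
     Put 8 (lo_expr (var 10)) (Get 8 (lo_expr (var 10)) +!
       (hi_expr (var 10) <! lo_expr (var 10) +! Cst 1)) ;;
     Put 10 (Cst 0) (var 10 +! Cst 1)).

Definition job_expr : expr := Get 9 (var 12).
Definition slot_expr : expr := lo_expr job_expr +! var 13.

(* The load of slot t under guess g is in cell t * n + g of array 14, so that each
   new guess finds empty slots. *)
Definition load_expr : expr := Get 14 (slot_expr *! var 0 +! var 11).

(* Arrays 11, 12, 13: the guess g (each slot may receive g + 1 jobs), the rank of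
   the current job, the offset from its first slot to the slot being examined. *)
Definition greedy_loop : cmd :=
  While (var 12 <! var 0)
    (If (hi_expr job_expr <! lo_expr job_expr +! Cst 1)
      (Put 13 (Cst 0) (Cst 0) ;; Put 12 (Cst 0) (var 12 +! Cst 1))
      (If (slot_expr <! hi_expr job_expr)
        (If (load_expr <! var 11 +! Cst 1)
          (Put 4 job_expr (Cst 2 *! load_expr) ;;
           Put 5 job_expr (slot_expr *! Get 2 job_expr) ;;
           Put 14 (slot_expr *! var 0 +! var 11) (load_expr +! Cst 1) ;;
           Put 13 (Cst 0) (Cst 0) ;;
           Put 12 (Cst 0) (var 12 +! Cst 1))
          (Put 13 (Cst 0) (var 13 +! Cst 1)))
        (Put 11 (Cst 0) (var 11 +! Cst 1) ;;
         Put 12 (Cst 0) (Cst 0) ;;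
         Put 13 (Cst 0) (Cst 0)))).

Definition approx_program : cmd := rank_loop ;; short_loop ;; greedy_loop.

(** * Ranks, boundary counts and the intended output *)

Section Program.

Variables (n : nat) (J : instance n) (p : int).
Hypotheses (validJ : valid_instance J) (procJ : forall j, proc (J j) = p).

Let lo := slot_lo J.
Let hi := slot_hi J.

(** Lexicographic order by deadline, then index, as indices are below n; ties never occur. *)
Definition key (j : 'I_n) : int := deadline (J j) * n%:Z + j%:Z.

Definition rank (j : 'I_n) : nat := #|[set i : 'I_n | key i < key j]|.

Lemma key_inj : injective key.
Proof.
move=> i j; rewrite /key => e; apply: val_inj => /=.
have ip := ltn_ord i; have jp := ltn_ord j.
have d : deadline (J i) = deadline (J j).
  by move: (deadline _) (deadline _) e => x y e; nia.
by move: e; rewrite d; lia.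
Qed.

Lemma rank_mono i j : key i < key j -> (rank i < rank j)%N.
Proof.
move=> ij; apply: proper_card; apply/properP; split.
  by apply/subsetP => l; rewrite !inE => /lt_trans; apply.
by exists i; rewrite !inE ?ij ?ltxx.
Qed.

Lemma rank_inj : injective rank.
Proof.
move=> i j e; apply: key_inj.
by case: (ltgtP (key i) (key j)) => // /rank_mono; rewrite e ltnn.
Qed.

Lemma rank_ltn j : (rank j < n)%N.
Proof.
rewrite -[X in (_ < X)%N]card_ord -cardsT; apply: proper_card; apply/properP.
by split; [exact: subsetT|exists j; rewrite !inE ?ltxx].
Qed.

Lemma rank_onto k : (k < n)%N -> exists j, rank j = k.
Proof.
move=> kn; pose f j := Ordinal (rank_ltn j).
have fI : injective f by move=> i j /(congr1 val) /rank_inj.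
by exists (invF fI (Ordinal kn)); have /(congr1 val) := f_invF fI (Ordinal kn).
Qed.

Lemma rank_hi i j : (rank i <= rank j)%N -> hi i <= hi j.
Proof.
rewrite leqNgt => /negP ij; have ks : key i <= key j by rewrite leNgt; apply/negP => /rank_mono.
have ip := ltn_ord i; have jp := ltn_ord j.
have : deadline (J i) <= deadline (J j).
  by move: ks; rewrite /key; move: (deadline _) (deadline _) => x y e; nia.
by rewrite /hi /slot_hi !procJ; apply: lez_pdiv2r; apply: ltW; exact: (proc_gt0 validJ procJ i).
Qed.

(** Content of cell t of array 8 after v rounds of [short_loop]. *)
Definition crossing (v : nat) (t : int) : nat :=
  #|[set j : 'I_n | [&& (j < v)%N, hi j <= lo j & lo j == t]]|.

Lemma crossingS (j : 'I_n) t :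
  crossing j.+1 t = (crossing j t + (hi j < lo j + 1)%R * (lo j == t))%N.
Proof.
rewrite /crossing mulnb ltzD1; case c : ((hi j <= lo j) && (lo j == t)).
  rewrite addn1 (_ : [set i : 'I_n | _] =
      j |: [set i : 'I_n | [&& (i < j)%N, hi i <= lo i & lo i == t]]).
    by rewrite cardsU1 !inE ltnn.
  apply/setP => i; rewrite !inE ltnS leq_eqVlt (inj_eq val_inj).
  by case: (eqVneq i j) => // ->; rewrite c.
rewrite addn0; apply: eq_card => i; rewrite !inE ltnS leq_eqVlt (inj_eq val_inj).
by case: (eqVneq i j) => // ->; rewrite c !andbF.
Qed.

Lemma crossing_le v t : (crossing v t <= n)%N.
Proof. by apply: leq_trans (max_card _) _; rewrite card_ord. Qed.

(* Short jobs use the odd machines, and boundaries of different parity use disjoint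
   sets of machines, so that the groups around adjacent boundaries do not collide. *)
Definition short_machine (j : 'I_n) : int :=
  4 * (crossing j (lo j))%:Z + (2 * (lo j - 2 * (lo j %/ 2)%Z) + 1).

Lemma parity_bounds (z : int) : 0 <= z - 2 * (z %/ 2)%Z <= 1.
Proof. lia. Qed.

(** Long jobs use the even machines. A long job of rank at least k is left unspecified, being still
    to be placed. *)
Definition job_outputs (s : state) (k : nat) slot level :=
  (forall j, hi j <= lo j -> s 4%N j%:Z = short_machine j /\ s 5%N j%:Z = release (J j)) /\
  (forall j, j \in placed lo hi rank k ->
     s 4%N j%:Z = (2 * level j)%N /\ s 5%N j%:Z = slot j * p).

(** Job i is counted for j but not for itself, so short jobs around one boundary get distinct
    machines. *)
Lemma crossing_ltn (i j : 'I_n) : (i < j)%N -> hi i <= lo i -> lo i = lo j ->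
  (crossing i (lo i) < crossing j (lo j))%N.
Proof.
move=> ij si e; apply: proper_card; apply/properP; split.
  by apply/subsetP => l; rewrite !inE e => /and3P[li -> ->]; rewrite (ltn_trans li ij).
by exists i; rewrite !inE ?ltnn // ij si e eqxx.
Qed.

Lemma slot_end_le (y z : int) : 0 < p -> y < z -> y * p + p <= z * p.
Proof.
move=> p0 yz; have -> : y * p + p = (y + 1) * p by rewrite mulrDl mul1r.
by rewrite ler_pM2r // lezD1. Qed.

(** * Feasibility of the output and number of machines *)

Section Output.

Variables (g x : nat) (slot : 'I_n -> int) (level : 'I_n -> nat) (s : state).
Hypotheses (G : greedy lo hi rank g n x slot level) (O : job_outputs s n slot level).

Definition output_machine (j : 'I_n) : nat := `|s 4%N j%:Z|.

Lemma long_placed j : lo j < hi j -> j \in placed lo hi rank n.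
Proof. by move=> l; rewrite inE rank_ltn l. Qed.

Lemma output_long j : lo j < hi j ->
  [/\ s 4%N j%:Z = (2 * level j)%N, output_machine j = (2 * level j)%N &
      s 5%N j%:Z = slot j * p].
Proof. by move/long_placed/O.2 => [e4 e5]; rewrite /output_machine e4. Qed.

Lemma short_machine_ge0 j : 0 <= short_machine j.
Proof. by have := parity_bounds (lo j); rewrite /short_machine; lia. Qed.

Lemma output_short j : hi j <= lo j ->
  [/\ s 4%N j%:Z = short_machine j, (output_machine j)%:Z = short_machine j &
      s 5%N j%:Z = release (J j)].
Proof.
move/O.1 => [e4 e5]; rewrite /output_machine e4; split=> //.
by rewrite gez0_abs // short_machine_ge0.
Qed.

Lemma output_machineE (j : 'I_n) : s 4%N j%:Z = (output_machine j)%:Z.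
Proof.
case: (ltP (lo j) (hi j)) => c; first by have [-> -> _] := output_long c.
by have [-> -> _] := output_short c.
Qed.

Lemma output_window (j : 'I_n) :
  release (J j) <= s 5%N j%:Z /\ s 5%N j%:Z + p <= deadline (J j).
Proof.
case: (ltP (lo j) (hi j)) => c; last first.
  by have [_ _ ->] := output_short c; split=> //; rewrite -(procJ j); exact: (validJ j).2.
have [_ _ ->] := output_long c; have /andP[a b] := greedy_window G (long_placed c).
have [r _] := release_bounds validJ procJ j; have [d _] := deadline_bounds validJ procJ j.
have p0 := proc_gt0 validJ procJ j.
split; first by apply: le_trans r _; rewrite ler_pM2r.
by apply: le_trans d; exact: slot_end_le.
Qed.

(** The parity of the machine separates long from short jobs. Two long jobs on one machine share a
    level, hence differ in slot; two short ones belong to boundaries at least two slots apart. *)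
Lemma output_disjoint (i j : 'I_n) : i != j -> output_machine i = output_machine j ->
  s 5%N i%:Z + p <= s 5%N j%:Z \/ s 5%N j%:Z + p <= s 5%N i%:Z.
Proof.
have p0 := proc_gt0 validJ procJ i.
have lt_mul (y z : int) := @slot_end_le y z p0.
move=> ij em; case: (ltP (lo i) (hi i)) => ci; case: (ltP (lo j) (hi j)) => cj.
- have [_ mi ->] := output_long ci; have [_ mj ->] := output_long cj.
  have D := greedy_distinct G (long_placed ci) (long_placed cj) ij.
  case: (ltgtP (slot i) (slot j)) => [lt|lt|/D]; [left|right|]; try exact: lt_mul.
  by move/eqP => D'; exfalso; apply: D'; lia.
- have [_ mi _] := output_long ci; have [_ mj _] := output_short cj.
  by move: mj; rewrite -em mi /short_machine; move: (lo j %/ 2)%Z => q; lia.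
- have [_ mi _] := output_short ci; have [_ mj _] := output_long cj.
  by move: mi; rewrite em mj /short_machine; move: (lo i %/ 2)%Z => q; lia.
have [_ mi ->] := output_short ci; have [_ mj ->] := output_short cj.
have [ri ri'] := release_bounds validJ procJ i.
have [rj rj'] := release_bounds validJ procJ j.
have E : short_machine i = short_machine j by rewrite -mi -mj em.
(* The parity term is 0 or 1, so the machine number determines both it and the count. *)
have [ec ep] : crossing i (lo i) = crossing j (lo j) /\
    lo i - 2 * (lo i %/ 2)%Z = lo j - 2 * (lo j %/ 2)%Z.
  move: E (parity_bounds (lo i)) (parity_bounds (lo j)); rewrite /short_machine.
  move: (lo i - _) (lo j - _) (crossing i _) (crossing j _) => a b c d; lia.
have ne : lo i <> lo j.
  move=> el; case: (ltngtP i j) => [lt|lt|/val_inj e].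
  - by have := crossing_ltn lt ci el; rewrite ec ltnn.
  - by have := crossing_ltn lt cj (esym el); rewrite ec ltnn.
  - by rewrite e eqxx in ij.
(* A short job starts after [(lo - 1) * p] and no later than [lo * p], so boundaries two slots apart
   give disjoint runs. *)
case: (ltP (lo i + 1) (lo j)) => c1.
  left; have := lt_mul _ _ c1; move: ri rj'; rewrite -/lo => *; lia.
case: (ltP (lo j + 1) (lo i)) => c2.
  right; have := lt_mul _ _ c2; move: rj ri'; rewrite -/lo => *; lia.
by move: (lo i) (lo j) ep ne c1 c2 => a b; lia.
Qed.

(** A raised guess g comes with more than g D long jobs in D slots, while at most 2 m D fit, so g <
    2 m; for g = 0 this is m > 0. Short jobs have a count below m, hence machines up to 4 (m - 1) +
    3. *)
Lemma output_machine_ltn m (S : schedule int n m) j : feasible J S ->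
  (output_machine j < 4 * m)%N.
Proof.
move=> feasS; have m0 : (0 < m)%N by apply: leq_ltn_trans (ltn_ord (machine S j)).
case: (ltP (lo j) (hi j)) => c.
  have [_ -> _] := output_long c; have /andP[_ lg] := greedy_level G (long_placed c).
  suff : (g < 2 * m)%N by lia.
  case: (greedy_witness G) => [->|[t0 [t1 [t01 H]]]]; first by lia.
  have := leq_trans H (long_jobs_card validJ procJ feasS t01).
  by rewrite ltn_mul2r => /andP[].
have [_ mj _] := output_short c.
suff : (crossing j (lo j) < m)%N.
  by move: mj (parity_bounds (lo j)); rewrite /short_machine; lia.
apply: leq_trans (short_group_card validJ procJ feasS j).
apply: proper_card; apply/properP; split.
  by apply/subsetP => l; rewrite !inE => /and3P[_ -> ->].
by exists j; rewrite !inE ?ltnn // c eqxx.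
Qed.

End Output.

(** * Execution of the three loops *)

Definition has_input (s : state) := s 0%N 0 = n%:Z /\ forall j : 'I_n,
  [/\ s 1%N j%:Z = release (J j), s 2%N j%:Z = proc (J j) & s 3%N j%:Z = deadline (J j)].

Lemma has_input_update s a z v : (3 < a)%N -> has_input s -> has_input (update s a z v).
Proof. by case: a => [|[|[|[|a]]]]. Qed.

Section Eval.

Variables (s : state) (e : expr) (j : 'I_n).
Hypotheses (Is : has_input s) (ej : eval s e = j%:Z).

Lemma eval_lo : eval s (lo_expr e) = lo j.
Proof. by rewrite !evalE ej; have [-> -> _] := Is.2 j. Qed.

Lemma eval_hi : eval s (hi_expr e) = hi j.
Proof. by rewrite !evalE ej; have [_ -> ->] := Is.2 j. Qed.

Lemma eval_key : eval s (key_expr e) = key j.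
Proof. by rewrite !evalE ej; have [_ _ ->] := Is.2 j; rewrite Is.1. Qed.

End Eval.

Variable B : nat.
(** [4 * n + 3] bounds the machine numbers and [n * n] the pair counter; start times lie between
    release dates and deadlines. *)
Hypotheses (B_ge2 : (2 <= B)%N) (B_n : (4 * n + 3 <= 2 ^ B)%N) (B_nn : (n * n <= 2 ^ B)%N).
Hypotheses (B_release : forall j, (`|release (J j)| <= 2 ^ B)%N)
  (B_deadline : forall j, (`|deadline (J j)| <= 2 ^ B)%N).

(** Exceeds the size of every expression in the program. *)
Local Notation W := 100%N.
Local Notation run := (run B W).
Local Notation bounded := (bounded B).

Lemma truth_gt0 (b : bool) : (0 < (b : nat)%:Z) = b.
Proof. by case: b. Qed.

Lemma truth_le0 (b : bool) : ((b : nat)%:Z <= 0) = ~~ b.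
Proof. by case: b. Qed.

(** Content of cell i of array 7 after v rounds: the pair (i, j) is visited in round [i * n + j],
    counting from 0. *)
Definition rank_upto (v : nat) (i : 'I_n) : nat :=
  #|[set j : 'I_n | (i * n + j < v)%N && (key j < key i)]|.

Lemma rank_uptoS v (i0 j0 i : 'I_n) : v = (i0 * n + j0)%N ->
  rank_upto v.+1 i = (rank_upto v i + (i == i0) * (key j0 < key i0)%R)%N.
Proof.
move=> ->; rewrite /rank_upto; have j0n := ltn_ord j0.
have [->|ne] := eqVneq i i0.
  case k0 : (key j0 < key i0); rewrite ?muln1 ?muln0 ?addn0.
    rewrite addn1 (_ : [set j : 'I_n | _] =
      j0 |: [set j : 'I_n | (i0 * n + j < i0 * n + j0)%N && (key j < key i0)]).
      by rewrite cardsU1 !inE ltnn.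
    apply/setP => j; rewrite !inE ltnS !ltn_add2l leq_add2l leq_eqVlt (inj_eq val_inj).
    by case: (eqVneq j j0) => // ->; rewrite k0.
  apply: eq_card => j; rewrite !inE ltnS !ltn_add2l leq_add2l leq_eqVlt (inj_eq val_inj).
  by case: (eqVneq j j0) => // ->; rewrite k0 !andbF.
rewrite mul0n addn0; apply: eq_card => j; rewrite !inE; congr (_ && _).
have /eqP ne' : (i : nat) != i0 by rewrite (inj_eq val_inj).
have jn := ltn_ord j; apply/idP/idP; last by lia.
by rewrite ltnS leq_eqVlt => /orP[/eqP e|//]; case: ne'; nia.
Qed.

Lemma run_rank_loop s : bounded s -> has_input s ->
  (forall a z, (6 <= a)%N -> s a z = 0) ->
  run rank_loop s (n * n * 4 + 1) (fun s' => [/\ has_input s',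
    forall j : 'I_n, s' 7%N j%:Z = (rank j)%:Z & forall a z, (8 <= a)%N -> s' a z = 0]).
Proof.
move=> bs Is s0.
pose I (v : nat) (s : state) := [/\ has_input s, (v <= n * n)%N, s 6%N 0 = v%:Z,
  forall i : 'I_n, s 7%N i%:Z = (rank_upto v i)%:Z & forall a z, (8 <= a)%N -> s a z = 0].
have I0 : I 0%N s.
  split=> //; [exact: s0 | move=> i; rewrite s0 // /rank_upto | by move=> a z a8; apply: s0; lia].
  by rewrite (_ : [set _ | _] = set0) ?cards0 //; apply/setP => j; rewrite !inE.
apply: run_weaken (run_while B_ge2 (N := n * n) (M := 3) (I := I) _ bs I0 _) => //.
  by rewrite subn0.
- move=> s' bs' [+ [v [Is' vn v6 s7 s8]]].
  rewrite !evalE v6 Is'.1 truth_le0 => g; split=> // i; rewrite s7; congr (Posz _).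
  apply: eq_card => j; rewrite !inE; have -> // : (i * n + j < v)%N.
  have := ltn_ord i; have := ltn_ord j; nia.
- move=> v t [It vn v6 t7 t8] bt; rewrite !evalE v6 It.1 truth_gt0 => g.
  have {}g : (v < n * n)%N by lia.
  split=> //; have n0 : (0 < n)%N by lia.
  have rn : (v %/ n < n)%N by rewrite ltn_divLR.
  pose i0 := Ordinal rn; pose j0 := Ordinal (ltn_pmod v n0).
  have vE : v = (i0 * n + j0)%N by exact: divn_eq.
  have er : eval t row_expr = i0%:Z by rewrite !evalE v6 It.1 divz_nat.
  have ec : eval t col_expr = j0%:Z.
    have -> : eval t col_expr = t 6%N 0 - eval t row_expr * t 0%N 0 by [].
    by rewrite er v6 It.1 {1}vE; lia.
  have [ekr ekc] := (eval_key It er, eval_key It ec).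
  have eput : eval t (Get 7 row_expr +! (key_expr col_expr <! key_expr row_expr)) =
     (rank_upto v.+1 i0)%:Z.
    rewrite (rank_uptoS _ vE) eqxx mul1n.
    have -> : eval t (Get 7 row_expr +! (key_expr col_expr <! key_expr row_expr)) =
      t 7%N (eval t row_expr) +
      (eval t (key_expr col_expr) < eval t (key_expr row_expr))%R%:Z by [].
    by rewrite er ekr ekc t7.
  apply: run_put_seq => //.
    rewrite eput /=; apply: leq_trans (max_card _) _; rewrite card_ord; lia.
  move=> bt'; rewrite er eput in bt' *; apply: run_put => //.
  all: rewrite !evalE /update /= v6.
    by lia.
  exists v.+1 => //; split.
  + do 2! apply: has_input_update => //.
  + by [].
  + by rewrite eqxx /=; lia.
  + move=> i; have -> : (i%:Z == (v %/ n)%N%:Z) = (i == i0) by [].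
    by case: (eqVneq i i0) => [->//|/negbTE ne] /=; rewrite t7 (rank_uptoS i vE) ne addn0.
  + by move=> a z a8; rewrite (gtn_eqF (ltnW a8)) (gtn_eqF a8) t8.
Qed.

Definition short_post (s : state) := [/\ has_input s,
  forall j : 'I_n, s 9%N (rank j)%:Z = j%:Z,
  forall j : 'I_n, s 4%N j%:Z = short_machine j /\ s 5%N j%:Z = release (J j) &
  forall a z, (11 <= a)%N -> s a z = 0].

Lemma run_short_loop s : bounded s -> has_input s ->
  (forall j : 'I_n, s 7%N j%:Z = (rank j)%:Z) -> (forall a z, (8 <= a)%N -> s a z = 0) ->
  run short_loop s (n * 10 + 1) short_post.
Proof.
move=> bs Is s7 s0.
pose I (v : nat) (s : state) := [/\ has_input s, (v <= n)%N /\ s 10%N 0 = v%:Z,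
  forall j : 'I_n, s 7%N j%:Z = (rank j)%:Z,
  forall j : 'I_n, (j < v)%N -> [/\ s 9%N (rank j)%:Z = j%:Z,
    s 4%N j%:Z = short_machine j & s 5%N j%:Z = release (J j)] &
  (forall z, s 8%N z = (crossing v z)%:Z) /\ (forall a z, (11 <= a)%N -> s a z = 0)].
have I0 : I 0%N s.
  split=> //; first by rewrite s0.
  split=> [z|a z a8]; rewrite s0 //; last by apply: leq_trans a8.
  by congr Posz; apply/esym/eqP; rewrite cards_eq0; apply/eqP/setP => j; rewrite !inE.
apply: run_weaken (run_while B_ge2 (N := n) (M := 9) (I := I) _ bs I0 _) => //.
  by rewrite subn0.
- move=> s' bs' [+ [v [Is' [vn v10] t7 tj [t8 t11]]]]; rewrite !evalE v10 Is'.1 truth_le0 => g.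
  have jv (j : 'I_n) : (j < v)%N by have := ltn_ord j; lia.
  by split=> // j; have [] := tj j (jv j).
move=> v t [It [vn v10] t7 tj [t8 t11]] bt; rewrite !evalE v10 It.1 truth_gt0 => g.
have {g}vn' : (v < n)%N by lia.
split=> //; pose j := Ordinal vn'; have jE : v%:Z = j%:Z by [].
rewrite jE in v10.
have ev (u : state) : u 10%N 0 = t 10%N 0 -> eval u (var 10) = j%:Z by rewrite evalE => ->.
apply: run_put_seq => //; first by rewrite evalE v10 /=; lia.
have -> : eval t (Get 7 (var 10)) = (rank j)%:Z by rewrite !evalE v10.
rewrite ev //; set t1 := update _ _ _ _ => bt1.
have I1 : has_input t1 by exact: has_input_update.
have e1 : eval t1 (var 10) = j%:Z by exact: ev.
have l1 := eval_lo I1 e1.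
have m1 : eval t1 (Cst 4 *! Get 8 (lo_expr (var 10)) +!
       (Cst 2 *! (lo_expr (var 10) -! Cst 2 *! (lo_expr (var 10) /! Cst 2)) +! Cst 1))
    = short_machine j.
  have -> : eval t1 (Cst 4 *! Get 8 (lo_expr (var 10)) +!
       (Cst 2 *! (lo_expr (var 10) -! Cst 2 *! (lo_expr (var 10) /! Cst 2)) +! Cst 1)) =
     4 * t1 8%N (eval t1 (lo_expr (var 10))) +
      (2 * (eval t1 (lo_expr (var 10)) - 2 * (eval t1 (lo_expr (var 10)) %/ 2)%Z) + 1) by [].
  by rewrite l1 /t1 /update /= t8.
apply: run_put_seq => //.
  rewrite m1 /short_machine; have := parity_bounds (lo j); have := crossing_le j (lo j).
  by move: (crossing _ _) (lo j %/ 2)%Z => c q; lia.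
rewrite m1 e1; set t2 := update t1 _ _ _ => bt2.
have I2 : has_input t2 by exact: has_input_update.
have e2 : eval t2 (var 10) = j%:Z by exact: ev.
have r2 : eval t2 (Get 1 (var 10)) = release (J j).
  by have [<- _ _] := I2.2 j; rewrite -e2.
apply: run_put_seq => //; first by rewrite r2.
rewrite r2 e2; set t3 := update t2 _ _ _ => bt3.
have I3 : has_input t3 by exact: has_input_update.
have e3 : eval t3 (var 10) = j%:Z by exact: ev.
have l3 := eval_lo I3 e3; have h3 := eval_hi I3 e3.
have c3 : eval t3 (Get 8 (lo_expr (var 10)) +! (hi_expr (var 10) <! lo_expr (var 10) +! Cst 1))
    = (crossing j.+1 (lo j))%:Z.
  have -> : eval t3 (Get 8 (lo_expr (var 10)) +! (hi_expr (var 10) <! lo_expr (var 10) +! Cst 1)) =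
    t3 8%N (eval t3 (lo_expr (var 10))) +
      (eval t3 (hi_expr (var 10)) < eval t3 (lo_expr (var 10)) + 1)%R%:Z by [].
  by rewrite l3 h3 /t3 /t2 /t1 /update /= t8 (crossingS j) eqxx muln1.
apply: run_put_seq => //.
  by rewrite c3 /=; apply: leq_trans (crossing_le _ _) _; lia.
rewrite c3 l3; set t4 := update t3 _ _ _ => bt4.
have i4 : eval t4 (var 10 +! Cst 1) = j.+1%:Z.
  by have -> : eval t4 (var 10 +! Cst 1) = t 10%N 0 + 1 by []; rewrite v10; lia.
apply: run_put => //; rewrite i4; first by rewrite /=; lia.
exists j.+1 => //; rewrite !evalE; split.
- exact: has_input_update.
- by split.
- by [].
- move=> i; rewrite ltnS leq_eqVlt (inj_eq val_inj).
  have rE : (rank i == rank j :> int) = (i == j) by rewrite eqz_nat (inj_eq rank_inj).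
  rewrite /t4 /t3 /t2 /t1 /update /= rE (_ : (i == v :> int) = (i == j)) //.
  by case: eqVneq => [->|_] //=; apply: tj.
split=> [z|a z a11]; rewrite /t4 /t3 /t2 /t1 /update /=.
  case: (eqVneq z (lo j)) => [->//|ne]; rewrite t8 (crossingS j z).
  by rewrite eq_sym (negbTE ne) muln0 addn0.
by rewrite ?(gtn_eqF a11) !(gtn_eqF (leq_trans _ a11)) // t11.
Qed.

Lemma cell_eq (t u : int) (g h : nat) : (g < n)%N -> (h < n)%N ->
  (t * n%:Z + g%:Z == u * n%:Z + h%:Z) = (t == u) && (g == h).
Proof.
move=> gn hn; apply/idP/idP => [/eqP e|/andP[/eqP-> /eqP->]] //.
have tu : t = u by nia.
by move: e; rewrite tu eqxx /=; lia.
Qed.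

Definition greedy_post (s : state) := exists g x slot level,
  greedy lo hi rank g n x slot level /\ job_outputs s n slot level.

(** The counter v has the digits g, k, x in base n + 1, and every branch raises it: placing or
    skipping raises k, a full slot raises x, a failure raises g. Cells of array 14 for guesses above
    g are still 0, so raising g empties all slots. *)
Definition greedy_inv (v : nat) (s : state) := exists g k x slot level,
  [/\ has_input s /\ (forall j : 'I_n, s 9%N (rank j)%:Z = j%:Z),
      [/\ v = ((g * n.+1 + k) * n.+1 + x)%N, (k <= n)%N,
          s 11%N 0 = g%:Z, s 12%N 0 = k%:Z & s 13%N 0 = x%:Z],
      greedy lo hi rank g k x slot level,
      job_outputs s k slot level &
      forall t h, (g <= h < n)%N ->
        s 14%N (t * n%:Z + h%:Z) = if h == g then (load lo hi rank slot k t)%:Z else 0].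

Lemma run_greedy_loop s : bounded s -> short_post s ->
  run greedy_loop s (n.+1 * n.+1 * n.+1 * 13 + 1) greedy_post.
Proof.
move=> bs [Is s9 s45 s0].
have I0 : greedy_inv 0 s.
  exists 0%N, 0%N, 0%N, (fun=> 0), (fun=> 0%N); split.
  - by [].
  - by split=> //; rewrite s0.
  - by apply: greedy0; left.
  - by split=> j; [move=> _; exact: s45|rewrite placed0 inE].
  - by move=> t h _; rewrite s0 // load0; case: ifP.
(* The longest branch has five assignments and four sequencing steps under three tests: 12 units. *)
apply: run_weaken (run_while B_ge2 (N := n.+1 * n.+1 * n.+1) (M := 12)
  (I := greedy_inv) _ bs I0 _) => //.
  move=> s' bs' [+ [v [g [k [x [slot [level [[Is' _] [_ kn _ t12 _] G [O1 O2] _]]]]]]]].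
  rewrite !evalE t12 Is'.1 truth_le0 => kn'.
  have {kn'}kn' : k = n by lia.
  by rewrite kn' in G O2; exists g, x, slot, level.
move=> v t [g [k [x [slot [level [[It t9] [-> kn t11 t12 t13] G O L]]]]]] bt.
rewrite !evalE t12 It.1 truth_gt0 => /= kn'.
have {kn kn'}kn : (k < n)%N by lia.
have xn := greedy_le_n G.
have gn : (g < n)%N.
  by case: (greedy_witness G) => [->|/hall_witness_ltn//]; lia.
split; first by nia.
have [j jk] := rank_onto kn; rewrite -jk in kn t12 G O L *.
set load_j := load lo hi rank slot (rank j) (lo j + x%:Z).
(* Stated for all states that agree with t on the relevant variables, since it is reused after the
   assignments to arrays 4 and 5. *)
have Hev (u : state) : has_input u -> (forall z, u 9%N z = t 9%N z) ->
    u 11%N 0 = t 11%N 0 -> u 12%N 0 = t 12%N 0 -> u 13%N 0 = t 13%N 0 ->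
    [/\ eval u job_expr = j%:Z, eval u (lo_expr job_expr) = lo j,
        eval u (hi_expr job_expr) = hi j, eval u slot_expr = lo j + x%:Z &
        eval u (slot_expr *! var 0 +! var 11) = (lo j + x%:Z) * n%:Z + g%:Z].
  move=> Iu u9 u11 u12 u13.
  have ej : eval u job_expr = j%:Z.
    by have -> : eval u job_expr = u 9%N (u 12%N 0) by []; rewrite u9 u12 t12 t9.
  have el := eval_lo Iu ej; have eh := eval_hi Iu ej.
  have es : eval u slot_expr = lo j + x%:Z.
    have -> : eval u slot_expr = eval u (lo_expr job_expr) + u 13%N 0 by [].
    by rewrite el u13 t13.
  split=> //.
  have -> : eval u (slot_expr *! var 0 +! var 11) = eval u slot_expr * u 0%N 0 + u 11%N 0 by [].
  by rewrite es u11 t11 Iu.1.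
have [ej el eh es ec] : [/\ eval t job_expr = j%:Z, eval t (lo_expr job_expr) = lo j,
        eval t (hi_expr job_expr) = hi j, eval t slot_expr = lo j + x%:Z &
        eval t (slot_expr *! var 0 +! var 11) = (lo j + x%:Z) * n%:Z + g%:Z] by exact: Hev.
have Lj : t 14%N ((lo j + x%:Z) * n%:Z + g%:Z) = load_j%:Z.
  by rewrite L ?eqxx // leqnn gn.
have load_n : (load_j <= n)%N by apply: leq_trans (max_card _) _; rewrite card_ord.
apply: run_if => //.
  have -> : eval t (hi_expr job_expr <! lo_expr job_expr +! Cst 1) =
    (eval t (hi_expr job_expr) < eval t (lo_expr job_expr) + 1)%R%:Z by [].
  rewrite truth_gt0 el eh ltzD1 => short.
  apply: (run_weaken (N := 3)) => //; first by move=> s' _ q; exact: q.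
  apply: run_put_seq => //; set t1 := update _ _ _ _ => bt1.
  have i1 : eval t1 (var 12 +! Cst 1) = (rank j).+1%:Z.
    by have -> : eval t1 (var 12 +! Cst 1) = t 12%N 0 + 1 by []; rewrite t12; lia.
  apply: run_put => //; rewrite i1; first by rewrite /=; lia.
  exists ((g * n.+1 + (rank j).+1) * n.+1 + 0)%N; first by nia.
  exists g, (rank j).+1, 0%N, slot, level; split.
  - by split=> //; do 2! apply: has_input_update => //.
  - by split=> //; lia.
  - exact (greedy_skip rank_inj G short).
  - have [O1 O2] := O; split=> [|i]; first exact: O1.
    by rewrite (placed_short rank_inj short); exact: O2.
  - by move=> u h hb; rewrite load_skip //; [exact: L|exact: rank_inj].
have -> : eval t (hi_expr job_expr <! lo_expr job_expr +! Cst 1) =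
  (eval t (hi_expr job_expr) < eval t (lo_expr job_expr) + 1)%R%:Z by [].
rewrite truth_le0 el eh ltzD1 -ltNge => long.
apply: run_if => //; have -> : eval t (slot_expr <! hi_expr job_expr) =
    (eval t slot_expr < eval t (hi_expr job_expr))%R%:Z by [].
all: rewrite (truth_gt0, truth_le0) es eh.
2: {
  rewrite -leNgt => late; have W1 := greedy_fail rank_hi G long late.
  have gn1 := hall_witness_ltn W1.
  apply: (run_weaken (N := 5)) => //; first by move=> s' _ q; exact: q.
  have g1 : eval t (var 11 +! Cst 1) = g.+1%:Z by rewrite !evalE t11; lia.
  apply: run_put_seq => //; first by rewrite g1 /=; lia.
  rewrite g1 => b1; apply: run_put_seq => // b2; apply: run_put => //.
  exists ((g.+1 * n.+1 + 0) * n.+1 + 0)%N; first by nia.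
  exists g.+1, 0%N, 0%N, slot, level; split.
  - by split=> //; do 3! apply: has_input_update => //.
  - by split.
  - by apply: greedy0; right.
  - by have [O1 O2] := O; split=> // i; rewrite placed0 inE.
  - move=> u h hb; rewrite /update /= L; last by lia.
    by rewrite load0 gtn_eqF ?if_same //; lia.
}
move=> inwin; apply: run_if => //.
all: have -> : eval t (load_expr <! var 11 +! Cst 1) =
    (t 14%N (eval t (slot_expr *! var 0 +! var 11)) < t 11%N 0 + 1)%R%:Z by [].
all: rewrite (truth_gt0, truth_le0) ec Lj t11 ltzD1 lez_nat.
2: {
  rewrite -ltnNge => full.
  apply: (run_weaken (N := 1)) => //; first by move=> s' _ q; exact: q.
  have x1 : eval t (var 13 +! Cst 1) = x.+1%:Z by rewrite !evalE t13; lia.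
  have G' := greedy_next rank_inj G full; have x1n := greedy_le_n G'.
  apply: run_put => //; rewrite x1 /=; first by lia.
  exists ((g * n.+1 + rank j) * n.+1 + x.+1)%N; first by lia.
  exists g, (rank j), x.+1, slot, level; split=> //.
  by split=> //; exact: ltnW.
}
move=> free.
have e1 : eval t (Cst 2 *! load_expr) = (2 * load_j)%N.
  have -> : eval t (Cst 2 *! load_expr) =
    2 * t 14%N (eval t (slot_expr *! var 0 +! var 11)) by [].
  by rewrite ec Lj.
apply: run_put_seq => //; first by rewrite e1 /=; lia.
rewrite e1 ej; set t1 := update _ _ _ _ => bt1.
have I1 : has_input t1 by exact: has_input_update.
have [ej1 _ _ es1 _] := Hev t1 I1 (fun=> erefl) erefl erefl erefl.
have e2 : eval t1 (slot_expr *! Get 2 job_expr) = (lo j + x%:Z) * p.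
  have -> : eval t1 (slot_expr *! Get 2 job_expr) =
    eval t1 slot_expr * t1 2%N (eval t1 job_expr) by [].
  by rewrite es1 ej1; have [_ -> _] := I1.2 j; rewrite procJ.
apply: run_put_seq => //.
  (* The start lies between the release date and the deadline, which bound its absolute value. *)
  rewrite e2; have [r1 _] := release_bounds validJ procJ j.
  have [d1 _] := deadline_bounds validJ procJ j; have p0 := proc_gt0 validJ procJ j.
  have := B_release j; have := B_deadline j.
  have a1 : lo j * p <= (lo j + x%:Z) * p by rewrite ler_pM2r //; lia.
  have a2 : (lo j + x%:Z) * p <= hi j * p by rewrite ler_pM2r // ltW.
  move: r1 d1; rewrite -/lo -/hi; move: ((lo j + x%:Z) * p) a1 a2 => z; lia.
rewrite e2 ej1; set t2 := update t1 _ _ _ => bt2.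
have I2 : has_input t2 by exact: has_input_update.
have [ej2 _ _ es2 ec2] := Hev t2 I2 (fun=> erefl) erefl erefl erefl.
have e3 : eval t2 (load_expr +! Cst 1) = load_j.+1%:Z.
  have -> : eval t2 (load_expr +! Cst 1) =
    t 14%N (eval t2 (slot_expr *! var 0 +! var 11)) + 1 by [].
  by rewrite ec2 Lj; lia.
apply: run_put_seq => //; first by rewrite e3 /=; lia.
rewrite e3 ec2; set t3 := update t2 _ _ _ => bt3.
apply: run_put_seq => //; set t4 := update t3 _ _ _ => bt4.
have i4 : eval t4 (var 12 +! Cst 1) = (rank j).+1%:Z.
  by have -> : eval t4 (var 12 +! Cst 1) = t 12%N 0 + 1 by []; rewrite t12; lia.
apply: run_put => //; rewrite i4; first by rewrite /=; lia.
exists ((g * n.+1 + (rank j).+1) * n.+1 + 0)%N; first by nia.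
exists g, (rank j).+1, 0%N, (fun i => if i == j then lo j + x%:Z else slot i),
  (fun i => if i == j then load_j else level i); split.
- by split=> //; do 3! apply: has_input_update => //.
- by split=> //; lia.
- exact (greedy_place rank_inj G long inwin free).
- have [O1 O2] := O; split=> i.
    move=> si; rewrite /t4 /t3 /t2 /t1 /update /= (_ : (i == j :> int) = (i == j)) //.
    case: eqVneq => [eij|_]; last exact: O1.
    by move: si long; rewrite eij; lia.
  rewrite placed_long //; last exact: rank_inj.
  rewrite in_setU1 /t4 /t3 /t2 /t1 /update /= (_ : (i == j :> int) = (i == j)) //.
  by case: eqVneq => [_ _|_ /= ip] //; exact: O2.
- move=> u h /andP[gh hn]; rewrite /t4 /t3 /t2 /t1 /update /= cell_eq // L ?gh //.
  rewrite load_place //; last exact: rank_inj.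
  case: (eqVneq h g) => [_|]; last by rewrite andbF.
  by rewrite andbT; case: eqVneq => [->|_]; rewrite ?addn1 ?addn0.
Qed.

Lemma input_has_input : has_input (input J).
Proof. by split=> // j; rewrite /= valK. Qed.

Lemma run_approx_program : bounded (input J) ->
  run approx_program (input J) (32 * n.+1 ^ 3) greedy_post.
Proof.
move=> bs.
apply: (run_weaken (N := ((n * n * 4 + 1) +
   ((n * 10 + 1) + (n.+1 * n.+1 * n.+1 * 13 + 1)).+1).+1)).
- rewrite !expnS expn0 muln1; move: (n) => k; nia.
- by move=> s' _ q; exact: q.
apply: run_seq => //; apply: run_weaken (run_rank_loop bs input_has_input _) => //.
  move=> s1 _ [I1 r1 z1] bs1.
  apply: run_seq => //; apply: run_weaken (run_short_loop bs1 I1 r1 z1) => //.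
  by move=> s2 _ P2 bs2; exact: run_greedy_loop.
by move=> [|[|[|[|[|[|a]]]]]].
Qed.

End Program.

(** * Binary lengths and the polynomial time bound *)

Lemma bitlen_gt z : (`|z| < 2 ^ bitlen z)%N.
Proof. exact: trunc_log_ltn. Qed.

Section InputSize.

Variables (n : nat) (J : instance n).
Let N := input_size J.

Lemma input_size_ge_n : (n <= N)%N.
Proof.
rewrite -[X in (X <= _)%N]card_ord -sum1_card; apply: leq_sum => j _.
by rewrite /bitlen; lia.
Qed.

Lemma job_size_le (f : job -> int) j :
  (bitlen (f (J j)) <= bitlen (release (J j)) + bitlen (proc (J j)) + bitlen (deadline (J j)))%N ->
  (`|f (J j)| <= 2 ^ N)%N.
Proof.
move=> H; apply: leq_trans (ltnW (bitlen_gt _)) _; rewrite leq_exp2l //.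
by apply: leq_trans H _; rewrite /N /input_size (bigD1 j) //= leq_addr.
Qed.

Lemma job_cell_le f (M : nat) z : (forall j, (`|f (J j)| <= M)%N) ->
  (`|job_cell J f z| <= M)%N.
Proof. by move=> H; case: z => [i|i] //=; case: insubP. Qed.

Lemma input_bounded B : (N <= B)%N -> bounded B (input J).
Proof.
move=> NB; have bB v : (v <= 2 ^ N)%N -> (v <= 2 ^ B)%N.
  by move/leq_trans; apply; rewrite leq_exp2l.
have nN : (n <= 2 ^ N)%N by apply: leq_trans input_size_ge_n _; exact: ltnW (ltn_expl _ _).
case=> [|[|[|[|a]]]] z /=; try by [].
- by case: ifP => _ //; exact: bB.
- by apply: job_cell_le => j; apply/bB/job_size_le; lia.
- by apply: job_cell_le => j; apply/bB/job_size_le; lia.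
- by apply: job_cell_le => j; apply/bB/job_size_le; lia.
Qed.

End InputSize.

(** The unit cost is linear in B, hence in the input size; with the cubic number of units this gives
    degree 4. *)
Lemma unit_cost_linear W N : (unit_cost (2 * N + 3) W <= unit_cost 3 W * N.+1)%N.
Proof. by rewrite /unit_cost; nia. Qed.

Lemma horner_succ_exp (c d N : nat) : (c%:P * ('X + 1) ^+ d).[N] = (c * N.+1 ^ d)%N.
Proof.
by rewrite hornerM hornerC horner_exp hornerD hornerX hornerC natrXE natrDE natrME addn1.
Qed.

Theorem theorem13 :
  exists c : cmd, approximation_algorithm 4 (@equal_proc) c.
Proof.
exists approx_program, ((32 * unit_cost 3 100)%N%:P * ('X + 1) ^+ 4).
move=> n J validJ [p procJ].
(* Since n < 2 ^ N, the value 2 ^ B = 8 * 4 ^ N exceeds both n * n and 4 * n + 3. *)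
set N := input_size J; pose B := (2 * N + 3)%N.
have nN : (n <= N)%N by exact: input_size_ge_n.
have NB : (N <= B)%N by rewrite /B; lia.
have n2 : (n < 2 ^ N)%N by apply: leq_ltn_trans nN (ltn_expl _ _).
have BE : (2 ^ B = 8 * (2 ^ N * 2 ^ N))%N by rewrite /B expnD mul2n -addnn expnD mulnC.
have [] := @run_approx_program n J p validJ procJ B.
- by rewrite /B; lia.
- by rewrite BE; nia.
- by rewrite BE; nia.
- by move=> j; apply: leq_trans (_ : 2 ^ N <= _)%N; [apply: job_size_le; lia|rewrite leq_exp2l].
- by move=> j; apply: leq_trans (_ : 2 ^ N <= _)%N; [apply: job_size_le; lia|rewrite leq_exp2l].
- exact: input_bounded.
move=> t [s [ex tle _ [g [x [slot [level [G O]]]]]]].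
pose mach (j : 'I_n) := output_machine s j.
(* One more than the largest machine number, and 0 when there are no jobs. *)
pose k := \max_(j < n) (mach j).+1.
have mk j : (mach j < k)%N by exact: (leq_bigmax j).
exists t, s, k, (Schedule (fun j => Ordinal (mk j)) (fun j => s 5%N j%:Z)); split.
- exact: ex.
- rewrite horner_succ_exp; apply: leq_trans tle _.
  have := unit_cost_linear 100 N; rewrite -/B.
  have n3 : (n.+1 ^ 3 <= N.+1 ^ 3)%N by rewrite leq_exp2r.
  rewrite (expnSr _ 3); move: (unit_cost B 100) (unit_cost 3 100) => u v uv.
  apply: leq_trans (leq_mul (leq_mul (leqnn 32) n3) uv) _.
  by move: (N.+1 ^ 3)%N => a; lia.
- by move=> j; rewrite /= (output_machineE O).
- split=> [j|i j ij /(congr1 val) /= e].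
    by rewrite /completion /= procJ !intz; exact: (output_window validJ procJ G O).
  by rewrite /completion /= !procJ !intz; exact: (output_disjoint validJ procJ G O).
- move=> R m [/int_schedule [S feasS] _]; apply/bigmax_leqP => j _.
  exact: (output_machine_ltn validJ procJ G O j feasS).
Qed.
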